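(* Let $q_\phi$ be a regular OrderSPN over $d=2^l$ variables ($l\ge1$), with $l$ sum (and $l$ product) layers and expansion factors $(K_0,\dots,K_{l-1})$. Then: (i) the size (number of edges) of $q_\phi$ is $$\sum_{i=1}^{l}(2^i+2^{i-1})\prod_{j<i}K_j;$$ (ii) the size of the support of $q_\phi$ in terms of orders, i.e. the number of orders $\sigma$ of $\{1,\dots,d\}$ with $q_\phi(\sigma,G)>0$ for some $G$, is $$\prod_{i=0}^{l-1}K_i^{2^i}.$$
   Context: For $S\subseteq\{1,\dots,d\}$, $\sigma_S$ denotes a linear ordering of $S$ and $G_S=(G_i)_{i\in S}$ a tuple of parent sets; a directed graph $G$ is the tuple $(G_1,\dots,G_d)$. A sum-product network (SPN) is a rooted DAG of leaf, product and sum nodes, each node representing a probability distribution over the variables in its scope. Leaves carry given distributions; a product node is the product of its children's distributions; a sum node $T$ is $\sum_i\phi_{T,i}C_i$ over its children, with weights $\phi_{T,i}>0$, $\sum_i\phi_{T,i}=1$. An OrderSPN $q_\phi$ is an SPN over $(\sigma,G)$ whose root is associated with $(\emptyset,\{1,\dots,d\})$ and such that: (1) Each leaf is associated with $(S_1,\{i\})$, $i\notin S_1$, has scope $(\sigma_{\{i\}},G_i)$, and its distribution has support only on $G_i\subseteq S_1$. (2) Each sum node is associated with disjoint $(S_1,S_2)$, $|S_2|>1$, has scope $(\sigma_{S_2},G_{S_2})$, and its $i$-th child is a product node associated with $(S_1,S_{21,i},S_{22,i})$ for some partition $(S_{21,i},S_{22,i})$ of $S_2$. (3) Each product node is associated with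 disjoint $(S_1,S_{21},S_{22})$, has scope $(\sigma_{S_{21}\cup S_{22}},G_{S_{21}\cup S_{22}})$ with the ordering being the concatenation $(\sigma_{S_{21}},\sigma_{S_{22}})$ (other orderings have probability $0$), and has two children (sum nodes or leaves), the first associated with $(S_1,S_{21})$ and the second with $(S_1\cup S_{21},S_{22})$. It is regular, with expansion factors $(K_0,\dots,K_{l-1})$, if it is organized in alternating sum and product layers starting from the root sum node (sum layer $0$), every sum node in sum layer $j$ has exactly $K_j$ children, and for each sum node with set $S_2$ all children satisfy $|S_{21,i}|=\lfloor|S_2|/2\rfloor$, $|S_{22,i}|=\lceil|S_2|/2\rceil$, with the ordered pairs $(S_{21,i},S_{22,i})$ distinct for different children. The underlying graph is a rooted tree: children are created separately for each parent, so every non-root node has a unique parent. *)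

(* Defs.v *)
From mathcomp Require Import all_boot all_order all_algebra.

Set Implicit Arguments.
Unset Strict Implicit.
Unset Printing Implicit Defensive.

Import Order.TTheory GRing.Theory Num.Theory.

(* A linear ordering of S is the list of its elements, first to last. *)
Definition is_order (d : nat) (S : {set 'I_d}) (s : seq 'I_d) : bool :=
  uniq s && ([set x in s] == S).

(* G i is the parent set of i. *)
Definition graph (d : nat) := {ffun 'I_d -> {set 'I_d}}.

Definition bipartition (d : nat) (S A B : {set 'I_d}) : bool :=
  [&& A != set0, B != set0, [disjoint A & B] & A :|: B == S].

(* The underlying graph of the networks considered is a rooted tree, so a
   network is a tree term: every occurrence of a subterm is a separate node,
   and structurally equal children remain distinct nodes. Nodes carry the sets
   they are associated with; the leaf [Leaf S1 i p] is associated with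
   (S1, {i}) and p is its distribution over the parent set of i. *)
Inductive spn (R : realFieldType) (d : nat) : Type :=
| Leaf (S1 : {set 'I_d}) (i : 'I_d) (p : {set 'I_d} -> R)
| Sum (S1 S2 : {set 'I_d}) (k : nat) (phi : 'I_k -> R) (c : 'I_k -> spn R d)
| Prod (S1 S21 S22 : {set 'I_d}) (c1 c2 : spn R d).

Arguments Leaf {R d} S1 i p.
Arguments Sum {R d} S1 S2 k phi c.
Arguments Prod {R d} S1 S21 S22 c1 c2.

Definition is_sum (R : realFieldType) (d : nat) (t : spn R d) : bool :=
  if t is Sum _ _ _ _ _ then true else false.

(* t is a sum node or a leaf associated with (S1, S2). *)
Definition sum_or_leaf_at (R : realFieldType) (d : nat) (S1 S2 : {set 'I_d})
    (t : spn R d) : Prop :=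
  match t with
  | Leaf A i _ => A = S1 /\ [set i] = S2
  | Sum A B _ _ _ => A = S1 /\ B = S2
  | Prod _ _ _ _ _ => False
  end.

Definition prod_at (R : realFieldType) (d : nat) (S1 S21 S22 : {set 'I_d})
    (t : spn R d) : Prop :=
  if t is Prod A B C _ _ then [/\ A = S1, B = S21 & C = S22] else False.

(* Junk value (set0, set0) outside product nodes. *)
Definition parts (R : realFieldType) (d : nat) (t : spn R d) :
    {set 'I_d} * {set 'I_d} :=
  if t is Prod _ A B _ _ then (A, B) else (set0, set0).

Local Open Scope ring_scope.

Fixpoint wf_spn (R : realFieldType) (d : nat) (t : spn R d) : Prop :=
  match t with
  | Leaf S1 i p =>
      [/\ i \notin S1, (forall A, 0 <= p A), \sum_(A : {set 'I_d}) p A = 1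
        & (forall A, p A != 0 -> A \subset S1)]
  | Sum S1 S2 k phi c =>
      [/\ [disjoint S1 & S2], (1 < #|S2|)%N,
          (forall i, 0 < phi i) /\ \sum_(i < k) phi i = 1,
          (forall i, exists S21 S22,
             bipartition S2 S21 S22 /\ prod_at S1 S21 S22 (c i))
        & (forall i, wf_spn (c i))]
  | Prod S1 S21 S22 c1 c2 =>
      [/\ [&& [disjoint S1 & S21], [disjoint S1 & S22] & [disjoint S21 & S22]],
          sum_or_leaf_at S1 S21 c1, sum_or_leaf_at (S1 :|: S21) S22 c2,
          wf_spn c1 & wf_spn c2]
  end.

Definition orderSPN (R : realFieldType) (d : nat) (t : spn R d) : Prop :=
  sum_or_leaf_at set0 [set: 'I_d] t /\ wf_spn t.

(* [spn_prob t s G] is the probability that node t, with scope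
   (sigma_S, G_S), gives to the ordering s of S and the restriction of G to S:
   it depends on G only through its values on S, and lists s that do not
   order S get probability 0. *)
Fixpoint spn_prob (R : realFieldType) (d : nat) (t : spn R d)
    (s : seq 'I_d) (G : graph d) : R :=
  match t with
  | Leaf _ i p => if s == [:: i] then p (G i) else 0
  | Sum _ _ k phi c => \sum_(i < k) phi i * spn_prob (c i) s G
  | Prod _ S21 S22 c1 c2 =>
      let s1 := take #|S21| s in
      let s2 := drop #|S21| s in
      if is_order S21 s1 && is_order S22 s2
      then spn_prob c1 s1 G * spn_prob c2 s2 G
      else 0
  end.

Local Close Scope ring_scope.

Fixpoint sum_layers (R : realFieldType) (d : nat) (t : spn R d) : nat :=
  match t with
  | Leaf _ _ _ => 0
  | Sum _ _ k _ c => (\max_(i < k) sum_layers (c i)).+1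
  | Prod _ _ _ c1 c2 => maxn (sum_layers c1) (sum_layers c2)
  end.

(* j is the layer index of t: the root is in sum layer 0, the product nodes in
   product layer j are the children of the sum nodes in sum layer j. *)
Fixpoint regular_from (R : realFieldType) (d : nat) (K : seq nat) (j : nat)
    (t : spn R d) : Prop :=
  match t with
  | Leaf _ _ _ => True
  | Sum _ S2 k _ c =>
      [/\ k = nth 0 K j,
          (forall i, #|(parts (c i)).1| = #|S2|./2
                  /\ #|(parts (c i)).2| = uphalf #|S2|),
          injective (fun i => parts (c i))
        & forall i, regular_from K j (c i)]
  | Prod _ _ _ c1 c2 => regular_from K j.+1 c1 /\ regular_from K j.+1 c2
  end.

(* Well-formedness already makes sum and product nodes alternate. *)
Definition regular_spn (R : realFieldType) (d : nat) (K : seq nat)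
    (t : spn R d) : Prop :=
  [/\ is_sum t, sum_layers t = size K & regular_from K 0 t].

Fixpoint num_edges (R : realFieldType) (d : nat) (t : spn R d) : nat :=
  match t with
  | Leaf _ _ _ => 0
  | Sum _ _ k _ c => k + \sum_(i < k) num_edges (c i)
  | Prod _ _ _ c1 c2 => 2 + (num_edges c1 + num_edges c2)
  end.

Definition order_support (R : realFieldType) (d : nat) (t : spn R d) :
    {set d.-tuple 'I_d} :=
  [set s : d.-tuple 'I_d | is_order [set: 'I_d] s
     & [exists G : graph d, (0 < spn_prob t s G)%R]].

(* Main.v *)
Require Import Defs.
From mathcomp Require Import all_boot all_order all_algebra.

(** The orders supported by a node can be listed recursively: a product node
    concatenates the orders of its children, and a sum node collects those of
    its children without repetition, because the first half of an order, as a
    set, determines the part [S21] and hence the child. So the support of a sum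
    node in layer [j] has size [N j = K j * N j.+1 ^ 2]; likewise it has
    [E j = K j * (3 + 2 * E j.+1)] edges below it. Both recursions stop at the
    leaves, reached after [l] halvings of [2 ^ l]. *)

Set Implicit Arguments.
Unset Strict Implicit.
Unset Printing Implicit Defensive.

Import Order.TTheory GRing.Theory Num.Theory.

Section Support.

Variables (R : realFieldType) (d : nat).
Implicit Types (t : spn R d) (s : seq 'I_d) (G : graph d) (S A B : {set 'I_d}).

Definition scope t : {set 'I_d} :=
  match t with
  | Leaf _ i _ => [set i]
  | Sum _ S2 _ _ _ => S2
  | Prod _ S21 S22 _ _ => S21 :|: S22
  end.

(** A list rather than a set: its length satisfies the counting recursion outright, and the absence
    of repetitions, which needs regularity, is proved separately. *)
Fixpoint orders t : seq (seq 'I_d) :=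
  match t with
  | Leaf _ i _ => [:: [:: i]]
  | Sum _ _ k _ c => [seq s | i <- enum 'I_k, s <- orders (c i)]
  | Prod _ _ _ c1 c2 => [seq s1 ++ s2 | s1 <- orders c1, s2 <- orders c2]
  end.

Lemma sum_or_leaf_at_scope S1 S t : sum_or_leaf_at S1 S t -> scope t = S.
Proof. by case: t => [? ? ?|? ? ? ? ?|? ? ? ? ?] //= []. Qed.

Lemma prod_at_scope S1 A B t : prod_at S1 A B t -> scope t = A :|: B.
Proof. by case: t => [? ? ?|? ? ? ? ?|? ? ? ? ?] //= [] _ -> ->. Qed.

Lemma is_order_size S s : is_order S s -> size s = #|S|.
Proof. by case/andP=> us /eqP <-; rewrite cardsE; apply/esym/card_uniqP. Qed.

Lemma is_order_cat A B s1 s2 : [disjoint A & B] ->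
  is_order A s1 -> is_order B s2 -> is_order (A :|: B) (s1 ++ s2).
Proof.
move=> dAB /andP[u1 /eqP e1] /andP[u2 /eqP e2]; apply/andP; split; last first.
  by apply/eqP/setP=> x; rewrite !inE mem_cat -e1 -e2 !inE.
rewrite cat_uniq u1 u2 andbT /=; apply/hasPn=> x xs2.
have xB : x \in B by rewrite -e2 inE.
by move: (disjointFl dAB xB); rewrite -e1 inE => ->.
Qed.

Lemma orders_is_order t : wf_spn t ->
  forall s, s \in orders t -> is_order (scope t) s.
Proof.
elim: t => [S1 i p|S1 S2 k phi c IH|S1 A B c1 IH1 c2 IH2] /=.
- move=> _ s; rewrite inE => /eqP->; apply/andP; split=> //.
  by apply/eqP/setP=> x; rewrite !inE.
- case=> _ _ _ hc wfc s /allpairsPdep [i [s' [_ hs' ->]]].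
  have [A [B [/and4P[_ _ _ /eqP <-] /prod_at_scope <-]]] := hc i.
  exact: IH.
- case=> /and3P[_ _ dAB] /sum_or_leaf_at_scope e1 /sum_or_leaf_at_scope e2.
  move=> w1 w2 s /allpairsP [[s1 s2] /= [h1 h2 ->]].
  by apply: is_order_cat => //; rewrite -?e1 -?e2; [apply: IH1|apply: IH2].
Qed.

Lemma spn_prob_ge0 t s G : wf_spn t -> (0 <= spn_prob t s G)%R.
Proof.
elim: t s => [S1 i p|S1 S2 k phi c IH|S1 A B c1 IH1 c2 IH2] s /=.
- by case=> _ p0 _ _; case: ifP.
- case=> _ _ [phi0 _] _ wfc; apply: sumr_ge0 => i _.
  by rewrite mulr_ge0 ?IH // ltW.
- by case=> _ _ _ w1 w2; case: ifP => // _; rewrite mulr_ge0 ?IH1 ?IH2.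
Qed.

(** Needed to glue the graphs chosen for the two children of a product node into one. *)
Lemma eq_spn_prob t s G G' : wf_spn t -> {in scope t, G =1 G'} ->
  spn_prob t s G = spn_prob t s G'.
Proof.
elim: t s => [S1 i p|S1 S2 k phi c IH|S1 A B c1 IH1 c2 IH2] s /=.
- by move=> _ eG; rewrite eG ?set11.
- case=> _ _ _ hc wfc eG; apply: eq_bigr => i _; congr (_ * _)%R.
  apply: IH => // x; have [A [B [/and4P[_ _ _ /eqP eS] /prod_at_scope ->]]] := hc i.
  by rewrite eS; apply: eG.
- case=> _ /sum_or_leaf_at_scope e1 /sum_or_leaf_at_scope e2 w1 w2 eG.
  case: ifP => // _; rewrite (IH1 _ w1) ?(IH2 _ w2) // => x.
    by rewrite e2 => xB; apply: eG; rewrite inE xB orbT.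
  by rewrite e1 => xA; apply: eG; rewrite inE xA.
Qed.

(** All probabilities are nonnegative, so a positive sum has a positive term and a positive product
    has two positive factors. *)
Lemma spn_prob_gt0_orders t s G : wf_spn t ->
  (0 < spn_prob t s G)%R -> s \in orders t.
Proof.
elim: t s => [S1 i p|S1 S2 k phi c IH|S1 A B c1 IH1 c2 IH2] s /=.
- by move=> _; case: eqP => [-> _|]; rewrite ?inE ?ltxx.
- case=> _ _ [phi0 _] _ wfc.
  case: (boolP [exists i, (0 < spn_prob (c i) s G)%R]) => [/existsP[i hi] _|].
    by apply/allpairsPdep; exists i, s; rewrite mem_enum; split=> //; apply: IH.
  move=> /existsPn h; rewrite big1 ?ltxx // => i _.
  have /eqP-> : spn_prob (c i) s G == 0%R.
    by rewrite eq_le spn_prob_ge0 // andbT leNgt.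
  by rewrite mulr0.
- case=> _ _ _ w1 w2; case: ifP => _; last by rewrite ltxx.
  set x := spn_prob c1 _ _; set y := spn_prob c2 _ _ => xy0.
  have x0 : (0 <= x)%R by apply: spn_prob_ge0.
  have y0 : (0 <= y)%R by apply: spn_prob_ge0.
  have [nx ny] : x != 0%R /\ y != 0%R.
    by apply/andP; rewrite -negb_or -mulf_eq0 gt_eqF.
  apply/allpairsP; exists (take #|A| s, drop #|A| s) => /=.
  by rewrite cat_take_drop; split=> //; [apply: IH1|apply: IH2];
    rewrite // lt_def ?nx ?ny.
Qed.

(** A leaf distribution sums to 1, so some parent set has positive mass; positive weights carry this
    through sum nodes, and gluing graphs carries it through product nodes. *)
Lemma orders_spn_prob_gt0 t s : wf_spn t -> s \in orders t ->
  exists G, (0 < spn_prob t s G)%R.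
Proof.
elim: t s => [S1 i p|S1 S2 k phi c IH|S1 A B c1 IH1 c2 IH2] s wft.
- move: wft => /= [_ p0 p1 _]; rewrite inE => /eqP->.
  case: (boolP [exists A, p A != 0%R]) => [/existsP[A hA]|/existsPn h].
    by exists [ffun _ => A]; rewrite eqxx ffunE lt_def hA p0.
  move: p1; rewrite big1 => [/eqP|A _]; first by rewrite eq_sym oner_eq0.
  by apply/eqP; have := h A; rewrite negbK.
- move: (wft) => /= [_ _ [phi0 _] _ wfc] /allpairsPdep [i [s' [_ hs' ->]]].
  have [G hG] := IH _ _ (wfc i) hs'; exists G.
  rewrite (bigD1 i) //=; apply: ltr_wpDr; last by rewrite mulr_gt0.
  by apply: sumr_ge0 => j _; rewrite mulr_ge0 ?spn_prob_ge0 // ltW.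
- move: wft => /= [/and3P[_ _ dAB] /sum_or_leaf_at_scope e1].
  move=> /sum_or_leaf_at_scope e2 w1 w2 /allpairsP [[s1 s2] /= [h1 h2 ->]].
  have o1 := orders_is_order w1 h1; have o2 := orders_is_order w2 h2.
  rewrite e1 in o1; rewrite e2 in o2.
  have [G1 p1] := IH1 _ w1 h1; have [G2 p2] := IH2 _ w2 h2.
  (* The parts are disjoint, so the glued graph agrees with [G1] on [A] and with [G2] on [B]. *)
  exists [ffun i => if i \in A then G1 i else G2 i].
  rewrite -(is_order_size o1) take_size_cat // drop_size_cat // o1 o2 /=.
  rewrite (eq_spn_prob (G' := G1) _ w1) ?(eq_spn_prob (G' := G2) _ w2);
    first exact: mulr_gt0.
    by move=> x; rewrite e2 ffunE => xB; rewrite (disjointFl dAB xB).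
  by move=> x; rewrite e1 ffunE => ->.
Qed.

(** Any order of a product node reveals its parts once the cut position [#|A|] is known; this
    separates the children of a sum node. *)
Lemma parts_orders S1 A B t s : prod_at S1 A B t -> wf_spn t -> s \in orders t ->
  parts t = ([set x in take #|A| s], [set x in drop #|A| s]).
Proof.
case: t => [? ? ?|? ? ? ? ?|S A' B' c1 c2] //= [_ -> _] [].
move=> _ /sum_or_leaf_at_scope e1 /sum_or_leaf_at_scope e2 w1 w2.
case/allpairsP=> [[s1 s2] /= [h1 h2 ->]].
have o1 := orders_is_order w1 h1; have o2 := orders_is_order w2 h2.
rewrite e1 in o1; rewrite e2 in o2.
rewrite -(is_order_size o1) take_size_cat // drop_size_cat //.
by case/andP: o1 => _ /eqP->; case/andP: o2 => _ /eqP->.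
Qed.

Lemma uniq_orders K j t : wf_spn t -> regular_from K j t -> uniq (orders t).
Proof.
elim: t j => [S1 i p|S1 S2 k phi c IH|S1 A B c1 IH1 c2 IH2] j //=.
- case=> _ _ _ hc wfc [_ hh inj reg].
  apply: allpairs_uniq_dep => [|i _|u v]; first exact: enum_uniq.
    exact: IH (wfc i) (reg i).
  case/allpairsPdep=> i [s [_ hs ->]] /allpairsPdep[i' [s' [_ hs' ->]]] /= ess'.
  move: hs'; rewrite -{}ess' => hs'.
  suff -> : i = i' by [].
  apply: inj; have [A [B [_ hp]]] := hc i; have [A' [B' [_ hp']]] := hc i'.
  rewrite /= (parts_orders hp (wfc i) hs) (parts_orders hp' (wfc i') hs').
  (* Regularity gives both children the same cut position, half of [#|S2|], so the common order [s]
     yields the same parts. *)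
  suff -> : #|A| = #|A'| by [].
  have [+ _] := hh i; have [+ _] := hh i'.
  by case: (c i) hp => //= ? ? ? ? ? [_ -> _];
    case: (c i') hp' => //= ? ? ? ? ? [_ -> _] -> ->.
- case=> _ _ _ w1 w2 [r1 r2]; apply: allpairs_uniq; [exact: IH1 w1 r1|
    exact: IH2 w2 r2|].
  move=> [s1 s2] [s1' s2'] /allpairsP[[? ?] /= [h1 h2 [-> ->]]].
  move=> /allpairsP[[? ?] /= [h1' h2' [-> ->]]] /eqP.
  (* A concatenation splits uniquely because all orders of [c1] have the same length. *)
  rewrite eqseq_cat; first by case/andP=> /eqP-> /eqP->.
  by rewrite !(is_order_size (orders_is_order w1 _)).
Qed.

(** Induction on the exponent [m], with the layer [j] general: each sum and product layer halves the
    set and moves to [j.+1]. *)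
Lemma regular_from_counts (K : seq nat) (m j : nat) (S1 S : {set 'I_d}) t :
  sum_or_leaf_at S1 S t -> wf_spn t -> regular_from K j t -> #|S| = 2 ^ m ->
  num_edges t =
    \sum_(i < m) (2 ^ i.+1 + 2 ^ i) * \prod_(h < i.+1) nth 0 K (j + h)
  /\ size (orders t) = \prod_(i < m) nth 0 K (j + i) ^ (2 ^ i).
Proof.
elim: m j S1 S t => [|m IH] j S1 S [T i p|T1 T2 k phi c|? ? ? ? ?] //=.
- by rewrite !big_ord0.
(* Size [2 ^ 0] excludes a sum node; in the next case the even size [2 ^ m.+1] excludes a leaf. *)
- by case=> _ -> [_ T2gt1 _ _ _] _ T2E; rewrite T2E in T2gt1.
- by case=> _ <- _ _; rewrite cards1 => /(congr1 odd); rewrite expnS mul2n odd_double.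
case=> _ <- [_ _ _ hc wfc] [kE hh _ reg] T2E.
set E := \sum_(i < m) (2 ^ i.+1 + 2 ^ i) * \prod_(h < i.+1) nth 0 K (j.+1 + h).
set N := \prod_(i < m) nth 0 K (j.+1 + i) ^ (2 ^ i).
have child i : num_edges (c i) = 2 + (E + E) /\ size (orders (c i)) = N * N.
  have := hc i; have := wfc i; have := hh i; have := reg i.
  case: (c i) => [? ? ?|? ? ? ? ?|U A B c1 c2] /= => [_ _ _|_ _ _|].
  - by case=> ? [? []].
  - by case=> ? [? []].
  (* As [2 ^ m.+1] is even, floor and ceiling of its half are both [2 ^ m], and the induction
     hypothesis fits both children. *)
  case=> r1 r2; rewrite T2E uphalf_half expnS mul2n doubleK odd_double.
  case=> cA cB [_ a1 a2 w1 w2] _.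
  have [e1 n1] := IH _ _ _ _ a1 w1 r1 cA.
  have [e2 n2] := IH _ _ _ _ a2 w2 r2 cB.
  by rewrite size_allpairs e1 e2 n1 n2.
split.
  under eq_bigr do rewrite (child _).1.
  (* The total is [k + k * (2 + 2 * E)]: here [k * 3] is the term [i = 0], as [3 = 2 ^ 1 + 2 ^ 0],
     and [k * 2] times [E] gives the shifted terms. *)
  rewrite sum_nat_const card_ord kE big_ord_recl /= big_ord1 addn0.
  rewrite mulnDr addnA -mulnS mulnC /E -big_split big_distrr /=.
  congr (_ + _); apply: eq_bigr => i _.
  rewrite [in RHS]big_ord_recl addn0 /= !(expnS 2 i.+1) (expnS 2 i).
  under [in RHS]eq_bigr do rewrite /bump /= add1n -addSnnS.
  by rewrite addnn -mul2n -mulnDr -mulnA mulnCA; congr (2 * _); rewrite mulnCA.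
rewrite size_allpairs_dep.
have -> : [seq size (orders (c i)) | i <- enum 'I_k]
        = [seq N * N | i <- enum 'I_k].
  by apply: eq_map => i; rewrite (child i).2.
rewrite sumnE big_map big_enum /= sum_nat_const card_ord kE.
rewrite big_ord_recl addn0 expn1; congr (_ * _).
(* Squaring [N] doubles each exponent [2 ^ i], matching the index shift. *)
rewrite -big_split /=; apply: eq_bigr => i _.
by rewrite /bump add1n -addSnnS expnS mul2n -addnn expnD.
Qed.

(** The support, read as lists through [val], and [orders t] are duplicate-free with the same
    members. *)
Lemma card_order_support K j t : scope t = [set: 'I_d] -> wf_spn t ->
  regular_from K j t -> #|order_support t| = size (orders t).
Proof.
move=> sT wft reg; rewrite cardE -(size_map val); apply/perm_size/uniq_perm.
- by rewrite map_inj_uniq ?enum_uniq //; exact: val_inj.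
- exact: uniq_orders wft reg.
move=> s; apply/mapP/idP => [[u]|hs].
  by rewrite mem_enum inE => /andP[_ /existsP[G hG]] ->;
    exact: spn_prob_gt0_orders wft hG.
have os := orders_is_order wft hs; rewrite sT in os.
have /eqP szs : size s = d by rewrite (is_order_size os) cardsT card_ord.
exists (Tuple szs) => //; rewrite mem_enum inE /= os.
by have [G hG] := orders_spn_prob_gt0 wft hs; apply/existsP; exists G.
Qed.

End Support.

Theorem proposition6 (R : realFieldType) (l : nat) (K : l.-tuple nat)
    (q : spn R (2 ^ l)) (hl : 1 <= l) (hq : orderSPN q)
    (hreg : regular_spn K q) :
  num_edges q =
    \sum_(1 <= i < l.+1) (2 ^ i + 2 ^ i.-1) * \prod_(j < i) nth 0 K j
  /\ #|order_support q| = \prod_(i < l) nth 0 K i ^ (2 ^ i).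
Proof.
case: hq => atT wfq; case: hreg => _ _ reg.
rewrite (card_order_support (sum_or_leaf_at_scope atT) wfq reg).
(* Shifting the index to start at 0 gives the form of the recursive count at [j = 0]. *)
rewrite big_add1 big_mkord.
have cT : #|[set: 'I_(2 ^ l)]| = 2 ^ l by rewrite cardsT card_ord.
exact: regular_from_counts atT wfq reg cT.
Qed.
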